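(* Let $m,n$ be integers with $0\le m\le n$ and $n\ge 1$. Then there is a polynomial $P_1(x;m,n)$ in $x$ of degree at most $\lfloor m/2\rfloor$ such that for all nonnegative integers $x$, $$D(x,x+m;n)=\prod_{i=1}^{n-1}\frac{(2x+m+i)!\,(3x+m+2i+2)_i\,(3x+2m+2i+2)_i}{(x+2i)!\,(x+m+2i)!}\cdot\frac{(2x+m)!}{(x+\lfloor m/2\rfloor)!\,(x+m)!}\cdot\prod_{i=0}^{\lfloor n/2\rfloor-1}\big(2x+2\lceil m/2\rceil+2i+1\big)\cdot P_1(x;m,n).$$ Moreover, if $n$ is odd and $m$ is even, then $P_1(x;m,n)$ is divisible by $2x+m+n$.
   Context: For integers $x,y$ and $n\ge1$, $D(x,y;n):=\det_{0\le i,j\le n-1}\Big(\sum_{x+2i-j<r\le y+2j-i}\binom{x+y+i+j}{r}\Big)$, where sums are signed sums: $\sum_{A<r\le B}\mathrm{Expr}(r)$ equals $\sum_{r=A+1}^{B}\mathrm{Expr}(r)$ if $A<B$, $0$ if $A=B$, and $-\sum_{r=B+1}^{A}\mathrm{Expr}(r)$ if $A>B$. Binomial coefficients $\binom{N}{k}$ vanish for $k<0$ or $k>N$. $(a)_k:=a(a+1)\cdots(a+k-1)$ for $k\ge1$ and $(a)_0:=1$. *)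

(* Defs.v *)
From mathcomp Require Import all_boot all_order all_algebra.
Set Implicit Arguments. Unset Strict Implicit. Unset Printing Implicit Defensive.
Import Order.TTheory GRing.Theory Num.Theory.
Local Open Scope ring_scope.

Definition binz (N k : int) : int :=
  if (0 <= k) && (k <= N) then ('C(`|N|%N, `|k|%N))%:Z else 0.

Definition ssum (A B : int) (f : int -> int) : int :=
  if A <= B then \sum_(k < `|B - A|%N) f (A + 1 + k%:Z)
  else - \sum_(k < `|A - B|%N) f (B + 1 + k%:Z).

Definition Dmat (x y : int) (n : nat) : 'M[int]_n :=
  \matrix_(i < n, j < n)
    ssum (x + 2 * (i : nat)%:Z - (j : nat)%:Z) (y + 2 * (j : nat)%:Z - (i : nat)%:Z)
         (fun r => binz (x + y + (i : nat)%:Z + (j : nat)%:Z) r).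

Definition D (x y : int) (n : nat) : int := \det (Dmat x y n).

Definition poch (a k : nat) : nat := \prod_(i < k) (a + i)%N.

(* Main.v *)
Require Import Defs.
From mathcomp Require Import all_boot all_order all_algebra.
From mathcomp Require Import perm ring lra zify.
Set Implicit Arguments. Unset Strict Implicit. Unset Printing Implicit Defensive.
Import Order.TTheory GRing.Theory Num.Theory.
Local Open Scope ring_scope.

(** Let g 0 (a, c) = 'C(a + c, a), let g 1 (a, c) be the sum of the 'C(a + c, r) over
    a < r <= c, to which a free multiple l of 2 ^ (a + c) is added, and let
    (k + 1) g (k + 2) = (c - a) g (k + 1) + (k + 1 + a + c) g k.  The determinant of the
    g 1 (x + 2i - j, y + 2j - i) for i, j < n equals g n (x, y) times an explicit product
    when x and y are not too small: by Desnanot-Jacobi condensation, induction on n reduces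
    this to a quadratic relation between the g's around a point, and shifting the point acts
    linearly on the pair (g n, g (n + 1)).  Condensation divides by a smaller determinant;
    this is legitimate because for generic l it does not vanish, by a Casoratian argument.
    The value l = 0 gives D.  Moving from (x, x + m) to the diagonal by
    2 g (k + 1) (a, c) = g (k + 1) (a + 1, c) + g k (a + 1, c), where the g's are products of
    odd numbers or zero, gives P_1 explicitly.  Small x is reached by polynomiality: both
    sides times a power of (x + K)! ^ 2 / (2 x)! are polynomials in x. *)

(** * The Desnanot-Jacobi identity *)

Section DesnanotJacobi.

Variable R : idomainType.

Definition minor n (i j : 'I_n.+1) (M : 'M[R]_n.+1) : R := \det (row' i (col' j M)).

Lemma minor_cofactor n (i j : 'I_n.+1) (M : 'M[R]_n.+1) :
  cofactor M i j = (-1) ^+ (i + j) * minor i j M.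
Proof. by []. Qed.

Lemma det_last_col_diag n (v : 'I_n.+1 -> R) :
  \det (\matrix_(i < n.+1, j < n.+1)
          (if j == ord_max then v i else (i == j)%:R)) = v ord_max.
Proof.
rewrite -det_tr det_trig; last first.
  apply/is_trig_mxP => i j ltij; rewrite !mxE.
  have -> : (i == ord_max) = false by apply/eqP => e; move: ltij; rewrite e /=; have := ltn_ord j; lia.
  by rewrite (_ : (j == i) = false) //; apply/eqP => e; move: ltij; rewrite e ltnn.
rewrite big_ord_recr /= !mxE eqxx big1 ?mul1r // => i _.
rewrite !mxE eqxx; case: ifP => // /eqP /(congr1 val) /=; have := ltn_ord i; lia.
Qed.

Lemma det_two_cols n (M : 'M[R]_n.+2) :
  (forall i j : 'I_n.+2, j != ord0 -> j != ord_max -> M i j = (i == j)%:R) ->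
  \det M = M ord0 ord0 * M ord_max ord_max - M ord0 ord_max * M ord_max ord0.
Proof.
move=> HM.
rewrite (expand_det_row _ ord0) big_ord_recl big_ord_recr /=.
rewrite big1 => [|i _]; last first.
  rewrite HM ?mul0r //; last by apply/eqP => /(congr1 val) /=; rewrite /bump /=; have := ltn_ord i; lia.
rewrite add0r /cofactor /= addn0 expr0 mul1r.
have -> : lift ord0 ord_max = ord_max :> 'I_n.+2 by apply/val_inj.
have -> : row' ord0 (col' ord0 M) = \matrix_(i < n.+1, j < n.+1)
          (if j == ord_max then M (lift ord0 i) ord_max else (i == j)%:R).
  apply/matrixP => i j; rewrite !mxE; case: eqP => [->|ne].
    by congr (M _ _); apply/val_inj.
  rewrite HM ?(inj_eq lift_inj) //.
  by apply/eqP => /(congr1 val) /= e; apply: ne; apply/val_inj => /=; rewrite /bump /= in e; lia.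
rewrite det_last_col_diag -mulrN; congr (_ * M _ _ + _ * _); first by apply/val_inj.
rewrite (expand_det_row _ ord_max) big_ord_recl /= big1 => [|i _]; last first.
  rewrite !mxE HM.
  - rewrite (_ : (_ == _) = false) ?mul0r //.
    by apply/eqP => /(congr1 val) /=; rewrite /bump /=; have := ltn_ord i; lia.
  - by apply/eqP => /(congr1 val) /=; rewrite /bump /=; have := ltn_ord i; lia.
  - by apply/eqP => /(congr1 val) /=; rewrite /bump /=; have := ltn_ord i; lia.
rewrite addr0 !mxE /cofactor /= addn0 add0n.
have -> : row' ord_max (col' ord0 (row' ord0 (col' ord_max M))) = 1%:M.
  apply/matrixP => i j; rewrite !mxE HM.
  - congr (nat_of_bool _)%:R; apply/eqP/eqP => [/(congr1 val)|/(congr1 val)] /=;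
    rewrite /bump /= => e; apply/val_inj => /=; have := ltn_ord i; have := ltn_ord j; rewrite /bump; lia.
  - by apply/eqP => /(congr1 val) /=; rewrite /bump /=; have := ltn_ord j; lia.
  - by apply/eqP => /(congr1 val) /=; rewrite /bump /=; have := ltn_ord j; lia.
rewrite det1 mulr1.
have -> : lift ord0 ord_max = ord_max :> 'I_n.+2 by apply/val_inj.
have -> : lift ord_max ord0 = ord0 :> 'I_n.+2 by apply/val_inj.
by rewrite mulrC exprS mulN1r mulrN -mulrA -expr2 sqrr_sign mulr1.
Qed.

(** [B] is the identity with its outer columns replaced by those of the adjugate of [M]. The outer
    columns of [M *m B] are [\det M] times unit vectors, so its determinant is [\det M ^+ 2] times
    the inner minor, and one factor [\det M] cancels. *)
Lemma desnanot_jacobi_regular n (M : 'M[R]_n.+2) : \det M != 0 ->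
  \det M * \det (row' ord0 (row' ord_max (col' ord0 (col' ord_max M)))) =
  minor ord0 ord0 M * minor ord_max ord_max M
  - minor ord0 ord_max M * minor ord_max ord0 M.
Proof.
move=> dM.
pose B : 'M[R]_n.+2 := \matrix_(i, j)
  if j == ord0 then (\adj M) i ord0
  else if j == ord_max then (\adj M) i ord_max else (i == j)%:R.
have dB : \det B = minor ord0 ord0 M * minor ord_max ord_max M
  - minor ord0 ord_max M * minor ord_max ord0 M.
  rewrite det_two_cols; last by move=> i j /negPf j0 /negPf jm; rewrite mxE j0 jm.
  rewrite !mxE /= !minor_cofactor /=.
  rewrite !addn0 !add0n expr0 mul1r -signr_odd addnn odd_double expr0 mul1r.
  by rewrite eqxx mulrACA -expr2 sqrr_sign mul1r; congr (_ - _); rewrite mulrC.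
have MB : M *m B = \matrix_(i, j)
  if j == ord0 then \det M *+ (i == ord0)
  else if j == ord_max then \det M *+ (i == ord_max) else M i j.
  apply/matrixP => i j; rewrite [LHS]mxE [RHS]mxE.
  have H k : \sum_j M i j * (\adj M) j k = \det M *+ (i == k).
    by have /matrixP/(_ i k) := mul_mx_adj M; rewrite !mxE.
  under eq_bigr do rewrite [B _ _]mxE.
  case: ifP => _; first exact: H.
  case: ifP => _; first exact: H.
  rewrite (bigD1 j) //= eqxx mulr1 big1 ?addr0 // => k /negPf ->; by rewrite mulr0.
apply: (mulfI dM); rewrite -dB -det_mulmx MB.
rewrite (expand_det_col _ ord0) big_ord_recl big1 => [|i _]; last by rewrite !mxE /= mul0r.
rewrite addr0 !mxE /= /cofactor /= addn0 expr0 mul1r; congr (_ * _).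
have mx1 : lift ord0 ord_max = ord_max :> 'I_n.+2 by apply/val_inj.
rewrite (expand_det_col _ ord_max) big_ord_recr big1 /= => [|i _]; last first.
  rewrite !mxE /= mx1 eqxx.
  rewrite (_ : (_ == _) = false) ?mul0r //.
  by apply/eqP => /(congr1 val) /=; rewrite /bump /=; have := ltn_ord i; lia.
rewrite add0r !mxE mx1 /= eqxx /cofactor -signr_odd addnn odd_double expr0 mul1r.
congr (_ * _); apply: congr1; apply/matrixP => i j; rewrite !mxE /=.
have E k : lift ord_max (lift ord0 k) = lift ord0 (lift ord_max k) :> 'I_n.+2.
  by apply/val_inj; rewrite /= /bump /=; have := ltn_ord k; lia.
rewrite -!E (_ : _ == ord_max = false) //.
by apply/eqP => /(congr1 val) /=; rewrite /bump /=; have := ltn_ord j; lia.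
Qed.

End DesnanotJacobi.

(** The matrix X + M over R[X] has a monic, hence nonzero, determinant; evaluating its identity at X
    = 0 removes the condition on [\det M]. *)
Lemma desnanot_jacobi (R : idomainType) n (M : 'M[R]_n.+2) :
  \det M * \det (row' ord0 (row' ord_max (col' ord0 (col' ord_max M)))) =
  minor ord0 ord0 M * minor ord_max ord_max M
  - minor ord0 ord_max M * minor ord_max ord0 M.
Proof.
pose C := char_poly_mx (- M).
have dC : \det C != 0 by rewrite -[\det C]/(char_poly (- M)) monic_neq0 // char_poly_monic.
have MC : map_mx (horner_eval 0) C = M.
  apply/matrixP => i j; rewrite !mxE /horner_eval hornerD hornerN hornerC opprK.
  by rewrite -mulr_natr hornerM hornerX mul0r add0r.
have mC i j : horner_eval 0 (minor i j C) = minor i j M.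
  by rewrite /minor -det_map_mx map_row' map_col' MC.
have mI : horner_eval 0 (\det (row' ord0 (row' ord_max (col' ord0 (col' ord_max C))))) =
    \det (row' ord0 (row' ord_max (col' ord0 (col' ord_max M)))).
  rewrite -det_map_mx -MC; congr (\det _); by apply/matrixP => i j; rewrite !mxE.
have mD : horner_eval 0 (\det C) = \det M by rewrite -det_map_mx MC.
by rewrite -mI -mD -!mC -!rmorphM -rmorphB desnanot_jacobi_regular.
Qed.

(** * Functions on the naturals given by rational polynomials *)

Definition polyfun (f : nat -> rat) := exists p : {poly rat}, forall x : nat, f x = p.[x%:R].

Lemma eventually0_poly (p : {poly rat}) x0 :
  (forall x : nat, (x0 <= x)%N -> p.[x%:R] = 0) -> p = 0.
Proof.
move=> p0; apply/eqP/negPn/negP => pn0.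
pose s := [seq (x0 + i)%:R : rat | i <- iota 0 (size p)].
suff /(max_poly_roots pn0) H : all (root p) s.
  suff /H : uniq s by rewrite size_map size_iota ltnn.
  by rewrite map_inj_uniq ?iota_uniq // => i j /eqP; rewrite eqr_nat eqn_add2l => /eqP.
by apply/allP => _ /mapP[i _ ->]; apply/eqP/p0/leq_addr.
Qed.

Lemma polyfun_ext f g x0 : polyfun f -> polyfun g ->
  (forall x, (x0 <= x)%N -> f x = g x) -> f =1 g.
Proof.
move=> [p fp] [q gq] fg x; apply/eqP; rewrite -subr_eq0 fp gq -hornerN -hornerD.
rewrite (@eventually0_poly (p - q) x0) ?horner0 // => y /fg.
by rewrite hornerD hornerN fp gq => ->; rewrite subrr.
Qed.

Lemma eq_polyfun f g : f =1 g -> polyfun f -> polyfun g.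
Proof. by move=> fg [p fp]; exists p => x; rewrite -fg. Qed.

Lemma polyfunC c : polyfun (fun _ => c).
Proof. by exists c%:P => x; rewrite hornerC. Qed.

Lemma polyfunX : polyfun (fun x => x%:R).
Proof. by exists 'X => x; rewrite hornerX. Qed.

Lemma polyfunD f g : polyfun f -> polyfun g -> polyfun (fun x => f x + g x).
Proof. by move=> [p fp] [q gq]; exists (p + q) => x; rewrite hornerD fp gq. Qed.

Lemma polyfunM f g : polyfun f -> polyfun g -> polyfun (fun x => f x * g x).
Proof. by move=> [p fp] [q gq]; exists (p * q) => x; rewrite hornerM fp gq. Qed.

Lemma polyfunN f : polyfun f -> polyfun (fun x => - f x).
Proof. by move=> [p fp]; exists (- p) => x; rewrite hornerN fp. Qed.

Lemma polyfun_sum I (r : seq I) (P : pred I) (F : I -> nat -> rat) :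
  (forall i, P i -> polyfun (F i)) -> polyfun (fun x => \sum_(i <- r | P i) F i x).
Proof.
move=> HF; elim: r => [|i r IH].
  by apply: eq_polyfun (polyfunC 0) => x; rewrite big_nil.
have [Pi|nPi] := boolP (P i).
  by apply: eq_polyfun (polyfunD (HF i Pi) IH) => x; rewrite big_cons Pi.
by apply: eq_polyfun IH => x; rewrite big_cons (negPf nPi).
Qed.

Lemma polyfun_prod I (r : seq I) (P : pred I) (F : I -> nat -> rat) :
  (forall i, P i -> polyfun (F i)) -> polyfun (fun x => \prod_(i <- r | P i) F i x).
Proof.
move=> HF; elim: r => [|i r IH].
  by apply: eq_polyfun (polyfunC 1) => x; rewrite big_nil.
have [Pi|nPi] := boolP (P i).
  by apply: eq_polyfun (polyfunM (HF i Pi) IH) => x; rewrite big_cons Pi.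
by apply: eq_polyfun IH => x; rewrite big_cons (negPf nPi).
Qed.

Lemma polyfun_det n (F : 'I_n -> 'I_n -> nat -> rat) : (forall i j, polyfun (F i j)) ->
  polyfun (fun x => \det (\matrix_(i, j) F i j x)).
Proof.
move=> HF.
apply: (@eq_polyfun (fun x => \sum_(s : {perm 'I_n}) (-1) ^+ s * \prod_i F i (s i) x)) => [x|].
  by apply: eq_bigr => s _; congr (_ * _); apply: eq_bigr => i _; rewrite mxE.
by apply: polyfun_sum => s _; apply: polyfunM; [exact: polyfunC | exact: polyfun_prod].
Qed.

(** [h] may vanish at some arguments; a single nonzero value makes its polynomial nonzero, and the
    cancellation is done between polynomials. *)
Lemma polyfun_mulIf f g h x1 : polyfun f -> polyfun g -> polyfun h -> h x1 != 0 ->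
  (forall x, f x * h x = g x * h x) -> f =1 g.
Proof.
move=> [p fp] [q gq] [r hr] hx1 fgh x; rewrite fp gq.
have -> // : p = q.
have r0 : r != 0 by apply: contraNneq hx1 => r0; rewrite hr r0 horner0.
apply: (mulIf r0); apply/eqP; rewrite -subr_eq0; apply/eqP.
apply: (@eventually0_poly _ 0) => y _.
by rewrite hornerD hornerN !hornerM -fp -gq -hr fgh subrr.
Qed.

(** * The functions [g]: recurrence, shifts and quadratic relation *)

Definition cumbin (N k : nat) : rat := \sum_(r < k.+1) ('C(N, r))%:R.

(** The state holds two consecutive terms, which makes the three-term recurrence structural. *)
Fixpoint gpair (l a c k : nat) : rat * rat :=
  if k is k'.+1 then
    let: (u, v) := gpair l a c k' in
    (v, ((c%:R - a%:R) * v + (k'.+1 + a + c)%:R * u) / k'.+1%:R)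
  else (('C(a + c, a))%:R,
        cumbin (a + c) c - cumbin (a + c) a + l%:R * 2 ^+ (a + c)).

Definition g (l k a c : nat) : rat := (gpair l a c k).1.

Lemma g0 l a c : g l 0 a c = ('C(a + c, a))%:R. Proof. by []. Qed.

Lemma gpair2 l k a c : (gpair l a c k).2 = g l k.+1 a c.
Proof. by rewrite /g /=; case: (gpair l a c k). Qed.

Lemma g1 l a c : g l 1 a c = cumbin (a + c) c - cumbin (a + c) a + l%:R * 2 ^+ (a + c).
Proof. by []. Qed.

Lemma gSS l k a c :
  g l k.+2 a c = ((c%:R - a%:R) * g l k.+1 a c + (k%:R + 1 + a%:R + c%:R) * g l k a c) / (k%:R + 1).
Proof.
rewrite {1}/g /= -/(gpair l a c k) -gpair2 /g; case: (gpair l a c k) => u v /=.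
by rewrite !natrD -!natr1.
Qed.

Lemma cumbinSr N k : cumbin N k.+1 = cumbin N k + ('C(N, k.+1))%:R.
Proof. exact: big_ord_recr. Qed.

Lemma cumbinSl N k : cumbin N k.+1 = 1 + \sum_(r < k.+1) ('C(N, r.+1))%:R.
Proof. by rewrite /cumbin big_ord_recl bin0. Qed.

Lemma cumbinSS N k : cumbin N.+1 k.+1 = 2 * cumbin N k + ('C(N, k.+1))%:R.
Proof.
rewrite cumbinSl; under eq_bigr do rewrite binS natrD.
rewrite big_split /= addrA -cumbinSl cumbinSr -/(cumbin N k); ring.
Qed.

Lemma cumbinS N k : cumbin N.+1 k = 2 * cumbin N k - ('C(N, k))%:R.
Proof.
case: k => [|k]; first by rewrite /cumbin !big_ord1 !bin0; ring.
rewrite cumbinSS cumbinSr; ring.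
Qed.

Lemma natr1_neq0 (n : nat) : n%:R + 1 != 0 :> rat.
Proof. by rewrite natr1 pnatr_eq0. Qed.

(** The base case is Pascal's rule; both formulas are proved together because the recurrence for
    [g l n.+2] calls on both. *)
Lemma g_shiftl l n a c :
  (a%:R + 1) * g l n a.+1 c = (n%:R + 1 + a%:R + c%:R) * g l n a c - n%:R * g l n.+1 a c /\
  (a%:R + 1) * g l n.+1 a.+1 c =
    (2 * a%:R + 2 + n%:R) * g l n.+1 a c - (n%:R + 1 + a%:R + c%:R) * g l n a c.
Proof.
elim: n => [|n [IH1 IH2]].
  have Ca : (a%:R + 1) * ('C((a + c).+1, a.+1))%:R = (a%:R + c%:R + 1) * ('C(a + c, a))%:R :> rat.
    by rewrite !natr1 -natrD natr1 -!natrM -mul_bin_diag.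
  rewrite !g0 !g1 mul0r subr0 addSn Ca; split; first ring.
  rewrite cumbinS cumbinSS exprS.
  have -> : ('C(a + c, c))%:R = ('C(a + c, a))%:R :> rat by rewrite -bin_sub ?leq_addl // addnK.
  have -> : ('C(a + c, a.+1))%:R = ('C((a + c).+1, a.+1))%:R - ('C(a + c, a))%:R :> rat.
    by rewrite binS natrD addrK.
  transitivity ((2 * a%:R + 2) * (cumbin (a + c) c - cumbin (a + c) a + l%:R * 2 ^+ (a + c))
    - (a%:R + 1) * ('C((a + c).+1, a.+1))%:R); first ring.
  by rewrite Ca; ring.
have n0 := natr1_neq0 n.
split; first by rewrite IH2 gSS -!natr1; field.
transitivity (((c%:R - a.+1%:R) * ((a%:R + 1) * g l n.+1 a.+1 c)
    + (n%:R + 1 + a.+1%:R + c%:R) * ((a%:R + 1) * g l n a.+1 c)) / (n%:R + 1)).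
  by rewrite [in LHS]gSS; field.
by rewrite IH1 IH2 [in RHS]gSS -!natr1; field.
Qed.

(** Mirror image of [g_shiftl]. Exchanging [a] and [c] multiplies [g l k] by (-1)^k only if [l] also
    changes sign, so a separate induction is run. *)
Lemma g_shiftr l n a c :
  (c%:R + 1) * g l n a c.+1 = (n%:R + 1 + a%:R + c%:R) * g l n a c + n%:R * g l n.+1 a c /\
  (c%:R + 1) * g l n.+1 a c.+1 =
    (2 * c%:R + 2 + n%:R) * g l n.+1 a c + (n%:R + 1 + a%:R + c%:R) * g l n a c.
Proof.
elim: n => [|n [IH1 IH2]].
  have CA : ('C(a + c, c))%:R = ('C(a + c, a))%:R :> rat by rewrite -bin_sub ?leq_addl // addnK.
  have Cs : 'C((a + c).+1, a) = 'C((a + c).+1, c.+1).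
    by rewrite -[RHS]bin_sub ?ltnS ?leq_addl // subSS addnK.
  have Cc : (c%:R + 1) * ('C((a + c).+1, a))%:R = (a%:R + c%:R + 1) * ('C(a + c, a))%:R :> rat.
    rewrite -CA Cs.
    by rewrite !natr1 -natrD natr1 -!natrM -mul_bin_diag.
  rewrite !g0 !g1 mul0r addr0 addnS Cc; split; first ring.
  rewrite cumbinSS cumbinS exprS.
  have -> : ('C(a + c, c.+1))%:R = ('C((a + c).+1, a))%:R - ('C(a + c, a))%:R :> rat.
    by rewrite -CA Cs binS natrD addrK.
  transitivity ((2 * c%:R + 2) * (cumbin (a + c) c - cumbin (a + c) a + l%:R * 2 ^+ (a + c))
    + (c%:R + 1) * ('C((a + c).+1, a))%:R); first ring.
  by rewrite Cc; ring.
have n0 := natr1_neq0 n.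
split; first by rewrite IH2 gSS -!natr1; field.
transitivity (((c.+1%:R - a%:R) * ((c%:R + 1) * g l n.+1 a c.+1)
    + (n%:R + 1 + a%:R + c.+1%:R) * ((c%:R + 1) * g l n a c.+1)) / (n%:R + 1)).
  by rewrite [in LHS]gSS; field.
by rewrite IH1 IH2 [in RHS]gSS -!natr1; field.
Qed.

(** Adding the two formulas of [g_shiftl] eliminates [g l n a c]. *)
Lemma g_contiguity l n a c : 2 * g l n.+1 a c = g l n.+1 a.+1 c + g l n a.+1 c.
Proof.
have [E1 E2] := g_shiftl l n a c; apply: (mulfI (natr1_neq0 a)).
by rewrite mulrDr E1 E2; ring.
Qed.

(** The solutions for [l] and [l'] obey the same recurrence, so their Casoratian is multiplied by
    -(n + 1 + a + c) / (n + 1) at each step; it starts at 'C(a + c, a) 2^(a + c) (l' - l). *)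
Lemma g_casoratian l l' n a c : l != l' -> g l n a c * g l' n.+1 a c != g l n.+1 a c * g l' n a c.
Proof.
move=> ll'; elim: n => [|n IH].
  rewrite !g0 !g1 -subr_eq0.
  rewrite (_ : _ - _ = ('C(a + c, a))%:R * 2 ^+ (a + c) * (l'%:R - l%:R)); last by ring.
  apply: mulf_neq0; last by rewrite subr_eq0 eqr_nat eq_sym.
  by rewrite mulf_neq0 ?expf_neq0 // pnatr_eq0 -lt0n bin_gt0 leq_addr.
have n0 := natr1_neq0 n.
rewrite !gSS -subr_eq0.
rewrite (_ : _ - _ = (n%:R + 1 + a%:R + c%:R) / (n%:R + 1)
  * (g l n.+1 a c * g l' n a c - g l n a c * g l' n.+1 a c)); last by field.
apply: mulf_neq0; last by rewrite subr_eq0 eq_sym.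
by rewrite mulf_neq0 ?invr_eq0 // natr1 -!natrD pnatr_eq0.
Qed.

Lemma polyfun_g n a c : polyfun (fun l => g l n a c).
Proof.
suff [] : polyfun (fun l => g l n a c) /\ polyfun (fun l => g l n.+1 a c) by [].
elim: n => [|n [IH1 IH2]].
  split; first exact: polyfunC.
  apply: polyfunD; first exact: polyfunC.
  by apply: polyfunM; [exact: polyfunX | exact: polyfunC].
split=> //; apply: (eq_polyfun (fun l => esym (gSS l n a c))).
by apply: polyfunM; [apply: polyfunD; apply: polyfunM |]; rewrite //; exact: polyfunC.
Qed.

Lemma g_shiftlE l n a c :
  (g l n a.+1 c = ((n%:R + 1 + a%:R + c%:R) * g l n a c - n%:R * g l n.+1 a c) / (a%:R + 1)) *
  (g l n.+1 a.+1 c =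
    ((2 * a%:R + 2 + n%:R) * g l n.+1 a c - (n%:R + 1 + a%:R + c%:R) * g l n a c) / (a%:R + 1)).
Proof.
have [E1 E2] := g_shiftl l n a c.
by rewrite -E1 -E2 ![(a%:R + 1) * _]mulrC !mulfK ?natr1_neq0.
Qed.

Lemma g_shiftrE l n a c :
  (g l n a c.+1 = ((n%:R + 1 + a%:R + c%:R) * g l n a c + n%:R * g l n.+1 a c) / (c%:R + 1)) *
  (g l n.+1 a c.+1 =
    ((2 * c%:R + 2 + n%:R) * g l n.+1 a c + (n%:R + 1 + a%:R + c%:R) * g l n a c) / (c%:R + 1)).
Proof.
have [E1 E2] := g_shiftr l n a c.
by rewrite -E1 -E2 ![(c%:R + 1) * _]mulrC !mulfK ?natr1_neq0.
Qed.

(** The shift formulas express every term through [g l n a c] and [g l n.+1 a c], leaving an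
    identity of quadratic forms in these two. The coefficients are those that [dfactorS] and
    [dconst_cross] contribute to condensation. *)
Lemma g_quadratic l n a c :
  (n%:R + 1) * (2 * a%:R + c%:R + 2 * n%:R + 7) * (a%:R + 2 * c%:R + 2 * n%:R + 7)
    * (g l n.+2 a.+1 c.+1 * g l n a.+2 c.+2) =
  (a%:R + 2 * n%:R + 3) * (c%:R + 2 * n%:R + 3) * (a%:R + c%:R + n%:R + 4)
    * (g l n.+1 a.+1 c.+1 * g l n.+1 a.+2 c.+2)
  - (a%:R + c%:R + 4) * (a%:R + 3) * (c%:R + 3) * (g l n.+1 a.+3 c * g l n.+1 a c.+3).
Proof.
have pn k : k%:R + 1 != 0 :> rat by exact: natr1_neq0.
have p2 k : k%:R + 2 != 0 :> rat by rewrite -natrD pnatr_eq0 addn2.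
have p3 k : k%:R + 3 != 0 :> rat by rewrite -natrD pnatr_eq0 addn3.
rewrite gSS.
rewrite !(g_shiftlE l n a.+2 c) !(g_shiftrE l n a c.+2) !(g_shiftlE l n a.+1 c.+2).
rewrite !(g_shiftlE l n a.+1 c) !(g_shiftlE l n a c.+2) !(g_shiftrE l n a c.+1).
rewrite !(g_shiftlE l n a c.+1) !(g_shiftrE l n a c) !(g_shiftlE l n a c).
rewrite -!natr1; move: (g l n a c) (g l n.+1 a c) => u v.
have := (pn a, p2 a, p3 a, pn c, p2 c, p3 c, pn n).
move: (a%:R : rat) (c%:R : rat) (n%:R : rat) => A C M [[[[[[H1 H2] H3] H4] H5] H6] H7].
field.
have E z : z + 1 + 1 = z + 2 :> rat by ring.
have E' z : z + 1 + 2 = z + 3 :> rat by ring.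
by rewrite !E !E' H1 H2 H3 H4 H5 H6.
Qed.

(** * The explicit product and its quotients *)

(** At y = x + m this is i! times the i-th factor of the product in the theorem. *)
Definition dfactor (x y i : nat) : rat :=
  (i`!)%:R * ((x + y + i)`!)%:R * (poch (2 * x + y + 2 * i + 2) i)%:R
    * (poch (x + 2 * y + 2 * i + 2) i)%:R / (((x + 2 * i)`!)%:R * ((y + 2 * i)`!)%:R).

(* The factor 'C(x + y, x)^-1 cancels g 0, so that the product formula also holds
   for the empty determinant. *)
Definition dconst (n x y : nat) : rat :=
  ('C(x + y, x))%:R^-1 * \prod_(i < n) dfactor x y i.

Lemma fact_neq0 (n : nat) : (n`!)%:R != 0 :> rat.
Proof. by rewrite pnatr_eq0 -lt0n fact_gt0. Qed.

Lemma bin_fact_rat a b : ('C(a + b, a))%:R = ((a + b)`!)%:R / ((a`!)%:R * (b`!)%:R) :> rat.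
Proof.
rewrite -(bin_fact (leq_addr b a)) addKn !natrM mulfK // mulf_neq0 ?fact_neq0 //.
Qed.

Lemma factSr n : (n.+1`!)%:R = (n%:R + 1) * (n`!)%:R :> rat.
Proof. by rewrite factS natrM natr1. Qed.

Lemma doubleSr x n : (x + 2 * n.+1 = (x + 2 * n).+2)%N.
Proof. by rewrite mulnS add2n !addnS. Qed.

Lemma dfactor0 x y : dfactor x y 0 = ('C(x + y, x))%:R.
Proof. by rewrite bin_fact_rat /dfactor /poch !big_ord0 fact0 muln0 !addn0 !mulr1 mul1r. Qed.

Lemma dconstS n x y : dconst n.+1 x y = dconst n x y * dfactor x y n.
Proof. by rewrite /dconst big_ord_recr /= mulrA. Qed.

(** Trading one unit of the index for one unit of both [x] and [y] removes just the leading factor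
    of each Pochhammer symbol. *)
Lemma dfactorS x y n :
  (x%:R + 2 * n%:R + 2) * (y%:R + 2 * n%:R + 2) * (x%:R + y%:R + n%:R + 2) * dfactor x y n.+1 =
  (n%:R + 1) * (2 * x%:R + y%:R + 2 * n%:R + 4) * (x%:R + 2 * y%:R + 2 * n%:R + 4)
    * dfactor x.+1 y.+1 n.
Proof.
have pS z k : poch z k.+1 = (z * poch z.+1 k)%N.
  by rewrite /poch big_ord_recl addn0; congr (_ * _)%N; apply: eq_bigr => i _; rewrite /= addSnnS.
rewrite /dfactor !pS.
have -> : (2 * x.+1 + y.+1 + 2 * n + 2 = (2 * x + y + 2 * n.+1 + 2).+1)%N by lia.
have -> : (x.+1 + 2 * y.+1 + 2 * n + 2 = (x + 2 * y + 2 * n.+1 + 2).+1)%N by lia.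
have -> : (x.+1 + y.+1 + n = (x + y + n).+2)%N by lia.
have -> : (x + y + n.+1 = (x + y + n).+1)%N by lia.
rewrite !(doubleSr x) !(doubleSr y) !(addSn _ (2 * n)) !factSr.
have := (fact_neq0 (x + 2 * n), fact_neq0 (y + 2 * n)).
rewrite !natrM; move: (poch _ n)%:R (poch _ n)%:R => p q.
move: ((x + 2 * n)`!)%:R ((y + 2 * n)`!)%:R ((x + y + n)`!)%:R (n`!)%:R => f1 f2 f3 f4.
move=> [F1 F2]; have := (ler0n rat x, ler0n rat y, ler0n rat n) => -[[Hx Hy] Hn].
by field; rewrite F1 F2 /= !lt0r_neq0 //; lra.
Qed.

(** The Pochhammer symbols on the two sides agree in pairs, so only factorials have to be
    compared. *)
Lemma dfactor_cross a c i :
  (a%:R + c%:R + i%:R + 4) * (a%:R + 2 * i%:R + 3) * (c%:R + 2 * i%:R + 3)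
    * (dfactor a.+3 c i * dfactor a c.+3 i) =
  (a%:R + c%:R + i%:R + 3) * (a%:R + 2 * i%:R + 1) * (c%:R + 2 * i%:R + 1)
    * (dfactor a.+1 c.+1 i * dfactor a.+2 c.+2 i).
Proof.
rewrite /dfactor.
have -> : (2 * a.+3 + c + 2 * i + 2 = 2 * a.+2 + c.+2 + 2 * i + 2)%N by lia.
have -> : (2 * a + c.+3 + 2 * i + 2 = 2 * a.+1 + c.+1 + 2 * i + 2)%N by lia.
have -> : (a + 2 * c.+3 + 2 * i + 2 = a.+2 + 2 * c.+2 + 2 * i + 2)%N by lia.
have -> : (a.+3 + 2 * c + 2 * i + 2 = a.+1 + 2 * c.+1 + 2 * i + 2)%N by lia.
rewrite !(addSn, addnS) !factSr.
have := (fact_neq0 (a + 2 * i), fact_neq0 (c + 2 * i)).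
move: (poch _ _)%:R (poch _ _)%:R (poch _ _)%:R (poch _ _)%:R => p1 p2 p3 p4.
move: ((a + 2 * i)`!)%:R ((c + 2 * i)`!)%:R ((a + c + i)`!)%:R (i`!)%:R => f1 f2 f3 f4.
move=> [F1 F2]; have := (ler0n rat a, ler0n rat c, ler0n rat i) => -[[Ha Hc] Hi].
by field; rewrite F1 F2 /= !lt0r_neq0 //; lra.
Qed.

(** A telescoping product: the left coefficient of [dfactor_cross] at i is its right coefficient at
    i + 1. The binomials in [dconst] give the case n = 0. *)
Lemma dconst_cross n a c :
  (a%:R + c%:R + n%:R + 3) * (a%:R + 2 * n%:R + 1) * (c%:R + 2 * n%:R + 1)
    * (dconst n a.+3 c * dconst n a c.+3) =
  (a%:R + c%:R + 4) * (a%:R + 3) * (c%:R + 3) * (dconst n a.+1 c.+1 * dconst n a.+2 c.+2).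
Proof.
elim: n => [|n IH].
  rewrite /dconst !big_ord0 !bin_fact_rat.
  rewrite !(addSn, addnS) !factSr.
  have := (fact_neq0 a, fact_neq0 c, fact_neq0 (a + c)).
  move: (a`!)%:R (c`!)%:R ((a + c)`!)%:R => f1 f2 f3 [[F1 F2] F3].
  have := (ler0n rat a, ler0n rat c) => -[Ha Hc].
  by field; rewrite F1 F2 F3 /= !lt0r_neq0 //; lra.
rewrite !dconstS.
pose k : rat := a%:R + c%:R + n%:R + 3; pose p : rat := a%:R + 2 * n%:R + 1.
pose q : rat := c%:R + 2 * n%:R + 1.
have kpq : k * p * q != 0.
  have := (ler0n rat a, ler0n rat c, ler0n rat n) => -[[Ha Hc] Hn].
  by rewrite !mulf_neq0 // /k /p /q lt0r_neq0 //; lra.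
apply: (mulfI kpq).
have -> : k * p * q * ((a%:R + c%:R + 4) * (a%:R + 3) * (c%:R + 3) *
  (dconst n a.+1 c.+1 * dfactor a.+1 c.+1 n * (dconst n a.+2 c.+2 * dfactor a.+2 c.+2 n))) =
  ((a%:R + c%:R + 4) * (a%:R + 3) * (c%:R + 3) * (dconst n a.+1 c.+1 * dconst n a.+2 c.+2))
  * (k * p * q * (dfactor a.+1 c.+1 n * dfactor a.+2 c.+2 n)) by ring.
rewrite -IH -dfactor_cross /k /p /q -!natr1; ring.
Qed.

Lemma poch_neq0 a k : (poch a.+1 k)%:R != 0 :> rat.
Proof. by rewrite pnatr_eq0 -lt0n /poch prodn_gt0. Qed.

Lemma dfactor_neq0 x y i : dfactor x y i != 0.
Proof.
by rewrite /dfactor !addnS !(mulf_neq0, invr_neq0) ?fact_neq0 ?poch_neq0.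
Qed.

Lemma bin_neq0 a b : ('C(a + b, a))%:R != 0 :> rat.
Proof. by rewrite pnatr_eq0 -lt0n bin_gt0 leq_addr. Qed.

Lemma dconst_neq0 n x y : dconst n x y != 0.
Proof.
rewrite mulf_neq0 ?invr_neq0 ?bin_neq0 //; apply/prodf_neq0 => i _; exact: dfactor_neq0.
Qed.

(** * Evaluation of the determinant by condensation *)

(** Subtraction is truncated; the entries are the intended ones when n <= x + 1 and n <= y + 1. *)
Definition gmat (l n x y : nat) : 'M[rat]_n :=
  \matrix_(i < n, j < n) g l 1 (x + 2 * i - j) (y + 2 * j - i).

(** Deleting outer rows and columns yields matrices of the same family: from (x, y), dropping the
    first row and column leads to (x + 1, y + 1), the first row and last column to (x + 2, y - 1),
    the last row and first column to (x - 1, y + 2). *)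
Lemma gmat_condensation l n a c : (n <= a)%N -> (n <= c)%N ->
  \det (gmat l n.+2 a.+1 c.+1) * \det (gmat l n a.+2 c.+2) =
  \det (gmat l n.+1 a.+1 c.+1) * \det (gmat l n.+1 a.+2 c.+2)
  - \det (gmat l n.+1 a.+3 c) * \det (gmat l n.+1 a c.+3).
Proof.
move=> na nc; set M := gmat l n.+2 a.+1 c.+1.
have lmax k (i : 'I_k) : lift ord_max i = i :> nat by rewrite /= /bump leqNgt ltn_ord.
have l0 k (i : 'I_k) : lift ord0 i = i.+1 :> nat by rewrite /= /bump.
have -> : gmat l n a.+2 c.+2 = row' ord0 (row' ord_max (col' ord0 (col' ord_max M))).
  by apply/matrixP => i j; rewrite !mxE !lmax !l0; congr (g _ _ _ _); lia.
rewrite desnanot_jacobi; congr (_ - _); last congr (_ * _); [rewrite mulrC; congr (_ * _)| |];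
  congr (\det _); apply/matrixP => i j; rewrite !mxE ?lmax ?l0; congr (g _ _ _ _);
  have := ltn_ord i; have := ltn_ord j; lia.
Qed.

Lemma polyfun_gdet n x y : polyfun (fun l => \det (gmat l n x y)).
Proof. by apply: polyfun_det => i j; exact: polyfun_g. Qed.

Lemma det_gmat l n x y : (n <= x.+1)%N -> (n <= y.+1)%N ->
  \det (gmat l n x y) = g l n x y * dconst n x y.
Proof.
pose P k := forall l x y, (k <= x.+1)%N -> (k <= y.+1)%N ->
  \det (gmat l k x y) = g l k x y * dconst k x y.
suff [H _] : P n /\ P n.+1 by exact: H.
elim: n {l x y} => [|n [IH1 IH2]].
  split=> l x y _ _; last first.
    rewrite det_mx11 mxE !muln0 !addn0 !subn0 dconstS dfactor0 /dconst big_ord0.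
    by rewrite mulr1 mulVf ?mulr1 ?bin_neq0.
  by rewrite det_mx00 g0 /dconst big_ord0 mulr1 divff ?bin_neq0.
split=> // l [|a] // [|c] //; rewrite !ltnS => na nc.
(* Were [g] zero for both l = 0 and l = 1, their Casoratian would vanish. *)
have [l1 hl1] : exists l1, g l1 n a.+2 c.+2 != 0.
  have := @g_casoratian 0 1 n a.+2 c.+2 isT.
  have [g0n|] := eqVneq (g 0 n a.+2 c.+2) 0; last by exists 0%N.
  have [g1n|] := eqVneq (g 1 n a.+2 c.+2) 0; last by exists 1%N.
  by rewrite g0n g1n mul0r mulr0 eqxx.
have IH1' l' : \det (gmat l' n a.+2 c.+2) = g l' n a.+2 c.+2 * dconst n a.+2 c.+2.
  by rewrite IH1 //; lia.
pose F l' := g l' n.+2 a.+1 c.+1 * dconst n.+2 a.+1 c.+1.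
have pF : polyfun F by apply: polyfunM; [exact: polyfun_g | exact: polyfunC].
(* Both sides are polynomials in [l], so it suffices to prove the equality multiplied by the
   determinant of size [n], even for those [l] where that determinant is zero. *)
apply: (polyfun_mulIf (polyfun_gdet _ _ _) pF (polyfun_gdet n a.+2 c.+2) (x1 := l1)).
  by rewrite IH1' mulf_neq0 ?dconst_neq0.
move=> {}l; rewrite gmat_condensation // IH1' !IH2 ?ltnS ?leqW // /F.
rewrite [dconst n.+2 _ _]dconstS [dconst _ a.+2 c.+2]dconstS.
(* This is the left coefficient of [dfactorS] at (a + 1, c + 1). *)
have D0 : (a%:R + 2 * n%:R + 3) * (c%:R + 2 * n%:R + 3) * (a%:R + c%:R + n%:R + 4) != 0 :> rat.
  have := (ler0n rat a, ler0n rat c, ler0n rat n) => -[[Ha Hc] Hn].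
  by rewrite !mulf_neq0 // lt0r_neq0 //; lra.
apply: (mulfI D0); symmetry.
transitivity (g l n.+2 a.+1 c.+1 * g l n a.+2 c.+2 * (dconst n.+1 a.+1 c.+1 * dconst n a.+2 c.+2)
  * ((a.+1%:R + 2 * n%:R + 2) * (c.+1%:R + 2 * n%:R + 2) * (a.+1%:R + c.+1%:R + n%:R + 2)
     * dfactor a.+1 c.+1 n.+1)); first ring.
rewrite dfactorS.
transitivity ((n%:R + 1) * (2 * a%:R + c%:R + 2 * n%:R + 7) * (a%:R + 2 * c%:R + 2 * n%:R + 7)
    * (g l n.+2 a.+1 c.+1 * g l n a.+2 c.+2)
    * (dconst n.+1 a.+1 c.+1 * dconst n a.+2 c.+2 * dfactor a.+2 c.+2 n)); first ring.
rewrite g_quadratic [RHS]mulrBr.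
transitivity ((a%:R + 2 * n%:R + 3) * (c%:R + 2 * n%:R + 3) * (a%:R + c%:R + n%:R + 4)
  * (g l n.+1 a.+1 c.+1 * g l n.+1 a.+2 c.+2)
  * (dconst n.+1 a.+1 c.+1 * (dconst n a.+2 c.+2 * dfactor a.+2 c.+2 n))
  - g l n.+1 a.+3 c * g l n.+1 a c.+3 * ((a%:R + c%:R + 4) * (a%:R + 3) * (c%:R + 3)
  * (dconst n.+1 a.+1 c.+1 * (dconst n a.+2 c.+2 * dfactor a.+2 c.+2 n)))); first ring.
rewrite -dconstS -dconst_cross; ring.
Qed.

(** * Identification of [D] with the case l = 0 *)

Lemma binz_nat (N k : nat) : binz N k = ('C(N, k))%:Z.
Proof.
by rewrite /binz le0z_nat lez_nat /=; case: leqP => // /bin_small ->.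
Qed.

Lemma cumbin_sub N a d :
  cumbin N (a + d) - cumbin N a = \sum_(k < d) ('C(N, a + 1 + k))%:R.
Proof.
elim: d => [|d IH]; first by rewrite addn0 subrr big_ord0.
by rewrite big_ord_recr /= -IH addnS cumbinSr addrAC addn1 addSn.
Qed.

Lemma ssum_binz (a c : nat) :
  (ssum a c (binz (a + c)%N))%:~R = cumbin (a + c) c - cumbin (a + c) a :> rat.
Proof.
have le_case (b d N : nat) : (\sum_(k < d) binz N (b%:Z + 1 + k%:Z))%:~R
    = cumbin N (b + d) - cumbin N b.
  rewrite cumbin_sub rmorph_sum /=; apply: eq_bigr => k _.
  by rewrite -!PoszD binz_nat.
rewrite /ssum lez_nat; case: leqP => [ac|/ltnW ca].
  by rewrite distnEl // le_case subnKC.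
by rewrite distnEl // mulrNz le_case subnKC // opprB.
Qed.

Lemma D_eq_g n x y : (n <= x.+1)%N -> (n <= y.+1)%N ->
  (D x y n)%:~R = g 0 n x y * dconst n x y.
Proof.
move=> nx ny; rewrite -det_gmat // -det_map_mx; congr (\det _).
apply/matrixP => i j; rewrite !mxE g1 mul0r addr0.
have := ltn_ord i; have := ltn_ord j => jn in'.
rewrite -ssum_binz; congr (_%:~R); congr (ssum _ _ (binz _)); lia.
Qed.

(** * Values on the diagonal and the explicit polynomial [P1] *)

(** For a = c the middle term of the recurrence vanishes, so the two parities decouple; with l = 0
    the odd chain starts at 0. *)
Lemma g_diag_odd l z : g 0 l.*2.+1 z z = 0.
Proof.
elim: l => [|l IH]; first by rewrite g1 subrr mul0r addr0.
by rewrite doubleS gSS IH mulr0 subrr mul0r addr0 mul0r.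
Qed.

Definition oddprod (a b : nat) : rat := \prod_(a <= t < b) (2 * t%:R + 1).

Lemma oddprod_cat a b c : (a <= b)%N -> (b <= c)%N -> oddprod a b * oddprod b c = oddprod a c.
Proof. by move=> ab bc; rewrite /oddprod -big_cat_nat. Qed.

Lemma oddprodS a b : (a <= b)%N -> oddprod a b.+1 = oddprod a b * (2 * b%:R + 1).
Proof. by move=> ab; rewrite /oddprod big_nat_recr. Qed.

Lemma oddprod_neq0 a b : oddprod a b != 0.
Proof.
by rewrite /oddprod prodf_seq_neq0; apply/allP => t _ /=; rewrite -natrM natr1_neq0.
Qed.

(** The even chain gains the factor (2z + 2l + 1) / (2l + 1) at each step. *)
Lemma g_diag_even l z : g 0 l.*2 z z = ('C(z + z, z))%:R * oddprod z (z + l) / oddprod 0 l.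
Proof.
elim: l => [|l IH].
  by rewrite g0 addn0 /oddprod !big_geq // mulr1 divr1.
rewrite doubleS gSS IH g_diag_odd mulr0 add0r addnS !oddprodS ?leq_addr //.
have := oddprod_neq0 0 l; have := ler0n rat l; have := ler0n rat z => z0 l0 o0.
rewrite -mul2n; field; rewrite o0 /= !lt0r_neq0 //; lra.
Qed.

Lemma pascal_sum m (h : nat -> rat) :
  \sum_(k < m.+2) ('C(m.+1, k))%:R * h k = \sum_(k < m.+1) ('C(m, k))%:R * (h k + h k.+1).
Proof.
rewrite big_ord_recl bin0.
under eq_bigr do rewrite binS natrD mulrDl.
under [RHS]eq_bigr do rewrite mulrDr.
rewrite !big_split /= addrA; congr (_ + _).
by rewrite big_ord_recr /= bin_small // mul0r addr0 [RHS]big_ord_recl bin0.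
Qed.

(** The m-fold iterate of [g_contiguity]; at c = a + m the right side lies on the diagonal. *)
Lemma g_expand l n m a c : (m <= n)%N ->
  2 ^+ m * g l n a c = \sum_(k < m.+1) ('C(m, k))%:R * g l (n - k) (a + m) c.
Proof.
elim: m n a => [|m IH] [|n] a //=.
- by rewrite big_ord1 /= bin0 addn0.
- by rewrite big_ord1 /= bin0 addn0 subn0.
rewrite ltnS => mn; rewrite exprSr -mulrA g_contiguity mulrDr !IH //; last exact: leqW.
rewrite -big_split (pascal_sum m (fun k => g l (n.+1 - k) (a + m.+1) c)) /=; apply: eq_bigr => k _; rewrite addSnnS subSS mulrDr.
by congr (_ + _).
Qed.

Lemma fact_double w : ((2 * w)`!)%:R = (w`!)%:R * 2 ^+ w * oddprod 0 w.
Proof.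
elim: w => [|w IH]; first by rewrite /oddprod big_geq // !mulr1.
rewrite mulnS add2n !factSr IH exprS oddprodS //; ring.
Qed.

Definition oddfactor (t : nat) : {poly rat} := 2 *: 'X + ((2 * t + 1)%N)%:R%:P.

Definition oddpoly (a b : nat) : {poly rat} := \prod_(a <= t < b) oddfactor t.

Lemma oddpolyE a b x : (oddpoly a b).[x%:R] = oddprod (x + a) (x + b).
Proof.
rewrite /oddpoly horner_prod /oddprod ![(x + _)%N]addnC big_addn addnK; apply: eq_bigr => t _.
rewrite hornerD hornerZ hornerX hornerC; ring.
Qed.

Lemma size_oddpoly a b : (size (oddpoly a b) <= (b - a).+1)%N.
Proof.
have [ab|ba] := leqP a b; last by rewrite /oddpoly big_geq ?size_poly1 // ltnW.
rewrite -(subnKC ab) addKn; move: (b - a)%N => d {b ab}.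
elim: d => [|d IH]; first by rewrite addn0 /oddpoly big_geq ?size_poly1.
rewrite addnS /oddpoly big_nat_recr ?leq_addr //=.
apply: leq_trans (size_polyMleq _ _) _.
have : (size (oddfactor (a + d)) <= 2)%N.
  apply: leq_trans (size_polyD _ _) _; rewrite geq_max.
  rewrite (leq_trans (size_polyC_leq1 _)) // andbT.
  by apply: leq_trans (size_scale_leq _ _) _; rewrite size_polyX.
by rewrite -/(oddpoly a (a + d)); move: (size _) (size _) IH => u v; lia.
Qed.

(** A summand is what is left of a term of [g_expand] once (2x + m)! and the linear factors
    displayed in the theorem are split off; terms with n - k odd vanish on the diagonal. The
    factorials i! come from [dfactor]. *)
Definition P1 (m n : nat) : {poly rat} :=
  (2 ^- m./2 * \prod_(1 <= i < n) (i`!)%:R) *: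
  \sum_(k < m.+1 | ~~ odd (n - k))
    (('C(m, k))%:R / oddprod 0 (n - k)./2) *: oddpoly (uphalf m + n./2) (m + (n - k)./2).

(** As (n - k)./2 <= n./2, each summand has at most m - uphalf m = m./2 linear factors. *)
Lemma size_P1 m n : (m <= n)%N -> (size (P1 m n) <= m./2 + 1)%N.
Proof.
move=> mn; apply: leq_trans (size_scale_leq _ _) _.
apply: leq_trans (size_sum _ _ _) _; apply/bigmax_leqP => k _.
apply: leq_trans (size_scale_leq _ _) _; apply: leq_trans (size_oddpoly _ _) _.
have := half_leq (leq_subr k n); rewrite uphalf_half; have := odd_double_half m; lia.
Qed.

(** The divisor is the first factor of every [oddpoly] in the sum. Parity forces k to be odd, hence
    k < m, so that no such product is empty. *)
Lemma dvdp_P1 m n : (m <= n)%N -> odd n && ~~ odd m ->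
  2%:R *: 'X + ((m + n)%N)%:R%:P %| P1 m n.
Proof.
move=> mn /andP[on em]; rewrite dvdpZr; last first.
  by rewrite mulf_neq0 ?invr_eq0 ?expf_neq0 // prodf_seq_neq0; apply/allP => i _; exact: fact_neq0.
set d := _ + _; apply: (big_ind (fun p => d %| p)) => [|p q|[k /= km] nk]; [exact: dvdp0 | exact: dvdp_add|].
rewrite -mul_polyC dvdp_mull // /oddpoly big_ltn; last by lia.
rewrite /d (_ : _ + _ = oddfactor (uphalf m + n./2)) ?dvdp_mulIl //.
congr (_ + _%:R%:P); lia.
Qed.

Lemma P1E m n x : (m <= n)%N ->
  ((2 * x + m)`!)%:R / (((x + m./2)`!)%:R * ((x + m)`!)%:R)
    * (\prod_(0 <= i < n./2) ((2 * x + 2 * uphalf m + 2 * i + 1)%N)%:R) * (P1 m n).[x%:R]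
  = (\prod_(1 <= i < n) (i`!)%:R) * g 0 n x (x + m).
Proof.
move=> mn; rewrite /P1 hornerZ.
set F := \prod_(_ <= _ < n) _.
have -> : \prod_(0 <= i < n./2) ((2 * x + 2 * uphalf m + 2 * i + 1)%N)%:R
    = oddprod (x + uphalf m) (x + uphalf m + n./2).
  rewrite /oddprod -{1}[(x + uphalf m)%N]add0n big_addn addKn.
  by apply: eq_bigr => i _; ring.
(* The even part of the factorial stops at the floor of m / 2, the odd part at its ceiling. *)
have fE : ((2 * x + m)`!)%:R = ((x + m./2)`!)%:R * 2 ^+ (x + m./2) * oddprod 0 (x + uphalf m).
  rewrite uphalf_half -{1}[m]odd_double_half; case: (odd m); last first.
    by rewrite !add0n -mul2n -mulnDr fact_double.
  have -> : (2 * x + (1 + m./2.*2) = (2 * (x + m./2)).+1)%N by lia.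
  rewrite factSr fact_double add1n addnS oddprodS //; ring.
have two : 2 != 0 :> rat by [].
apply: (mulfI (expf_neq0 m two)).
rewrite [RHS]mulrCA g_expand // horner_sum.
rewrite big_mkcond /= !mulr_sumr; apply: eq_bigr => -[k /= km] _.
case: ifPn => [ek|]; last first.
  rewrite negbK => ok; rewrite -[(n - k)%N]odd_double_half ok add1n g_diag_odd.
  by rewrite !mulr0.
have nk : (n - k = (n - k)./2.*2)%N by rewrite -{1}[(n - k)%N]odd_double_half (negPf ek).
set l := (n - k)./2 in nk *; rewrite nk g_diag_even bin_fact_rat addnn -mul2n fact_double fE.
rewrite hornerZ oddpolyE.
(* [O1] and [O2] cut the same product of odd numbers in two ways, one for each side of the
   equation. *)
have O1 : oddprod 0 (x + uphalf m) * oddprod (x + uphalf m) (x + uphalf m + n./2)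
    * oddprod (x + (uphalf m + n./2)) (x + (m + l)) = oddprod 0 (x + m + l).
  by rewrite -!addnA !oddprod_cat //; lia.
have O2 : oddprod 0 (x + m) * oddprod (x + m) (x + m + l) = oddprod 0 (x + m + l).
  by rewrite oddprod_cat // leq_addr.
transitivity (F * ('C(m, k))%:R / oddprod 0 l / ((x + m)`!)%:R * (2 ^+ m * 2 ^+ x)
  * oddprod 0 (x + m + l)); [rewrite -O1 | rewrite -O2].
all: rewrite !exprD; field.
all: by rewrite !(oddprod_neq0, fact_neq0, expf_neq0).
Qed.

(** * Polynomiality of both sides in [x] after scaling *)

(** For large [K] this turns 'C(2x + e, x + f) into a polynomial in x: each (x + K)! absorbs one
    factorial of the denominator, and (2x)! divides the numerator. *)
Definition dscale (K x : nat) : rat := ((x + K)`!)%:R ^+ 2 / ((2 * x)`!)%:R.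

Lemma dscale_neq0 K x : dscale K x != 0.
Proof. by rewrite mulf_neq0 ?invr_neq0 ?expf_neq0 ?fact_neq0. Qed.

Lemma fact_rising a d : ((a + d)`!)%:R = (a`!)%:R * \prod_(i < d) (a%:R + 1 + i%:R) :> rat.
Proof.
elim: d => [|d IH]; first by rewrite addn0 big_ord0 mulr1.
by rewrite addnS factSr IH big_ord_recr /= natrD; ring.
Qed.

Lemma polyfun_rising (c d : rat) k : polyfun (fun x => \prod_(i < k) (c * x%:R + d + i%:R)).
Proof.
apply: polyfun_prod => i _; apply: polyfunD; [apply: polyfunD |]; try exact: polyfunC.
by apply: polyfunM; [exact: polyfunC | exact: polyfunX].
Qed.

(* The ratio (x + K)! / (x + f)! as a polynomial in x, with 1 / (x + f)! read as 0
   when x + f < 0. *)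
Definition fact_ratio (K : nat) (f : int) (x : nat) : rat :=
  \prod_(i < `|K%:Z - f|) (1 * x%:R + (f%:~R + 1) + i%:R).

Lemma polyfun_fact_ratio K f : polyfun (fact_ratio K f).
Proof. exact: polyfun_rising. Qed.

Lemma fact_ratioE K f x p : f <= K%:Z -> x%:Z + f = p%:Z ->
  ((x + K)`!)%:R = (p`!)%:R * fact_ratio K f x.
Proof.
move=> fK xf; have -> : (x + K = p + `|(K%:Z - f)%R|)%N by lia.
rewrite fact_rising; congr (_ * _); apply: eq_bigr => i _.
by rewrite mul1r addrA (_ : p%:R = p%:Z%:~R) // -xf intrD.
Qed.

Lemma fact_ratio0 K f x : f <= K%:Z -> x%:Z + f < 0 -> fact_ratio K f x = 0.
Proof.
move=> fK xf; have lt : (`|(x%:Z + f + 1)%R| < `|(K%:Z - f)%R|)%N by lia.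
(* The factor with index -(x + f + 1) is zero. *)
rewrite /fact_ratio (bigD1 (Ordinal lt)) //=.
have -> : `|(x%:Z + f + 1)%R|%:R = (- (x%:Z + f + 1))%:~R :> rat.
  by rewrite -[LHS]/(`|(x%:Z + f + 1)%R|%N%:Z%:~R); congr (_%:~R); lia.
rewrite mulrNz !intrD; apply/eqP; rewrite mulf_eq0; apply/orP; left; apply/eqP; ring.
Qed.

(** The two ranges where [binz] vanishes, x + f < 0 and x + (e - f) < 0, are those where one of the
    two [fact_ratio] vanishes. *)
Lemma binz_scale K (e x : nat) (f : int) : f <= K%:Z -> e%:Z - f <= K%:Z ->
  (binz (2 * x + e)%N (x%:Z + f))%:~R * dscale K x =
  (\prod_(i < e) (2 * x%:R + 1 + i%:R)) * fact_ratio K f x * fact_ratio K (e%:Z - f) x.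
Proof.
move=> fK eK; rewrite /binz.
have [f0|f0] := leP 0 (x%:Z + f); last by rewrite /= mul0r (fact_ratio0 fK f0) mulr0 mul0r.
have [f1|f1] /= := leP (x%:Z + f) (2 * x + e)%N; last first.
  by rewrite mul0r (@fact_ratio0 K (e%:Z - f)) ?mulr0 //; lia.
pose p := `|(x%:Z + f)%R|%N; pose q := `|(x%:Z + (e%:Z - f))%R|%N.
have fp : x%:Z + f = p%:Z by lia.
have fq : x%:Z + (e%:Z - f) = q%:Z by lia.
have pq : (2 * x + e = p + q)%N by lia.
rewrite fp -/p absz_nat pq -[_%:~R]/(('C(p + q, p))%:R) bin_fact_rat -pq fact_rising.
rewrite /dscale expr2 {1}(fact_ratioE fK fp) (fact_ratioE eK fq).
have := fact_neq0 p; have := fact_neq0 q; have := fact_neq0 (2 * x) => F1 F2 F3.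
rewrite natrM; field; by rewrite F1 F2 F3.
Qed.

Lemma polyfun_binz_scale K (e : nat) (f : int) : f <= K%:Z -> e%:Z - f <= K%:Z ->
  polyfun (fun x => (binz (2 * x + e)%N (x%:Z + f))%:~R * dscale K x).
Proof.
move=> fK eK; apply: (eq_polyfun (fun x => esym (binz_scale x fK eK))).
by apply: polyfunM; [apply: polyfunM; [exact: polyfun_rising|] |]; exact: polyfun_fact_ratio.
Qed.

(** The sign and the number of terms of the signed sum depend on [A] and [B] alone, so for all [x]
    it is one fixed sum of scaled binomials. *)
Lemma polyfun_ssum_scale K (e : nat) (A B : int) : A <= K%:Z -> B <= K%:Z -> A + B = e%:Z ->
  polyfun (fun x => (ssum (x%:Z + A) (x%:Z + B) (binz (2 * x + e)%N))%:~R * dscale K x).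
Proof.
move=> AK BK AB.
have H (C : int) d : C + d%:Z <= K%:Z -> e%:Z - C - 1 <= K%:Z -> polyfun (fun x =>
    (\sum_(k < d) binz (2 * x + e)%N (x%:Z + C + 1 + k%:Z))%:~R * dscale K x).
  move=> CK eC; apply: (@eq_polyfun (fun x =>
    \sum_(k < d) (binz (2 * x + e)%N (x%:Z + (C + 1 + k%:Z)))%:~R * dscale K x)) => [x|].
    by rewrite rmorph_sum mulr_suml; apply: eq_bigr => k _; rewrite !addrA.
  by apply: polyfun_sum => k _; apply: polyfun_binz_scale; have := ltn_ord k; lia.
have [leAB|ltBA] := leP A B.
  apply: eq_polyfun (H A `|(B - A)%R|%N _ _) => [x||]; [|lia|lia].
  rewrite /ssum lerD2l leAB; congr (_%:~R * _).
  by rewrite (_ : x%:Z + B - (x%:Z + A) = B - A) //; ring.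
apply: eq_polyfun (polyfunN (H B `|(A - B)%R|%N _ _)) => [x||]; [|lia|lia].
rewrite /ssum lerD2l leNgt ltBA /= mulrNz mulNr; congr (- (_%:~R * _)).
by rewrite (_ : x%:Z + A - (x%:Z + B) = A - B) //; ring.
Qed.

(** Each of the [n] rows takes one factor [dscale]; K = m + 2n bounds every offset in the matrix. *)
Lemma polyfun_D_scale m n :
  polyfun (fun x => (D x%:Z (x + m)%N%:Z n)%:~R * dscale (m + 2 * n) x ^+ n).
Proof.
pose F (i j : 'I_n) (x : nat) : rat :=
  (ssum (x%:Z + (2 * (i : nat)%:Z - (j : nat)%:Z)) (x%:Z + (m%:Z + 2 * (j : nat)%:Z - (i : nat)%:Z))
    (binz (2 * x + (m + i + j))%N))%:~R * dscale (m + 2 * n) x.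
apply: (@eq_polyfun (fun x => \det (\matrix_(i, j) F i j x))) => [x|]; last first.
  by apply: polyfun_det => i j; apply: polyfun_ssum_scale; have := ltn_ord i; have := ltn_ord j; lia.
rewrite /D -det_map_mx [RHS]mulrC -detZ; congr (\det _); apply/matrixP => i j.
rewrite !mxE [RHS]mulrC.
by congr (_%:~R * _); congr (ssum _ _ (binz _)); lia.
Qed.

Lemma polyfun_prod_nat a b (F : nat -> nat -> rat) :
  (forall i, (a <= i < b)%N -> polyfun (F i)) -> polyfun (fun x => \prod_(a <= i < b) F i x).
Proof.
move=> HF; apply: (@eq_polyfun (fun x => \prod_(a <= i < b | (a <= i < b)%N) F i x)) => [x|].
  by rewrite [RHS]big_nat_cond; under [RHS]eq_bigl do rewrite andbT.
exact: polyfun_prod.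
Qed.

Lemma polyfun_poch c d k : polyfun (fun x => (poch (c * x + d) k)%:R).
Proof.
apply: (@eq_polyfun (fun x => \prod_(i < k) (c%:R * x%:R + d%:R + i%:R))) => [x|].
  by rewrite /poch natr_prod; apply: eq_bigr => i _; rewrite !natrD natrM.
exact: polyfun_rising.
Qed.

Lemma polyfun_fact_scale K e f f' : (f <= K)%N -> (f' <= K)%N ->
  polyfun (fun x => ((2 * x + e)`!)%:R / (((x + f)`!)%:R * ((x + f')`!)%:R) * dscale K x).
Proof.
move=> fK fK'; apply: (@eq_polyfun (fun x =>
  (\prod_(i < e) (2 * x%:R + 1 + i%:R)) * fact_ratio K f x * fact_ratio K f' x)) => [x|].
  rewrite /dscale expr2 {1}(@fact_ratioE K f x (x + f)) // (@fact_ratioE K f' x (x + f')) //.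
  rewrite (fact_rising (2 * x)) natrM.
  have := fact_neq0 (x + f); have := fact_neq0 (x + f'); have := fact_neq0 (2 * x) => F1 F2 F3.
  by field; rewrite F1 F2 F3.
by apply: polyfunM; [apply: polyfunM; [exact: polyfun_rising|] |]; exact: polyfun_fact_ratio.
Qed.

Definition rhs (m n : nat) (P : {poly rat}) (x : nat) : rat :=
  (\prod_(1 <= i < n)
    (((2 * x + m + i)`!)%:R * (poch (3 * x + m + 2 * i + 2) i)%:R
       * (poch (3 * x + 2 * m + 2 * i + 2) i)%:R
     / (((x + 2 * i)`!)%:R * ((x + m + 2 * i)`!)%:R)))
  * (((2 * x + m)`!)%:R / (((x + m./2)`!)%:R * ((x + m)`!)%:R))
  * (\prod_(0 <= i < n./2) ((2 * x + 2 * uphalf m + 2 * i + 1)%N)%:R)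
  * P.[x%:R].

(** There are [n] factorial quotients, n - 1 in the product and one outside, and each takes one
    factor [dscale]. *)
Lemma polyfun_rhs_scale m n P : (0 < n)%N ->
  polyfun (fun x => rhs m n P x * dscale (m + 2 * n) x ^+ n).
Proof.
move=> n0; pose K := (m + 2 * n)%N.
apply: (@eq_polyfun (fun x =>
  (\prod_(1 <= i < n) ((poch (3 * x + (m + 2 * i + 2)) i)%:R
       * (poch (3 * x + (2 * m + 2 * i + 2)) i)%:R
    * (((2 * x + (m + i))`!)%:R / (((x + 2 * i)`!)%:R * ((x + (m + 2 * i))`!)%:R) * dscale K x)))
  * (((2 * x + m)`!)%:R / (((x + m./2)`!)%:R * ((x + m)`!)%:R) * dscale K x)
  * (\prod_(0 <= i < n./2) (2 * x%:R + (2 * uphalf m + 1 + 2 * i)%N%:R))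
  * P.[x%:R])) => [x|].
  have -> : dscale (m + 2 * n) x ^+ n = dscale K x * \prod_(1 <= i < n) dscale K x.
    by rewrite prodr_const_nat -exprS subn1 prednK.
  rewrite /rhs -!mulrA [_ * \prod_(1 <= i < n) dscale K x]mulrC.
  set Q := \prod_(0 <= i < n./2) _; set R := \prod_(0 <= i < n./2) _.
  have -> : Q = R by apply: eq_bigr => i _; rewrite -natrM -natrD; congr (_%:R); lia.
  set A := \prod_(1 <= i < n) _; set B := \prod_(1 <= i < n) dscale K x; set C := \prod_(1 <= i < n) _.
  have -> : A = C * B.
    rewrite -big_split; apply: eq_bigr => i _ /=; rewrite !addnA.
    by ring.
  ring.
apply: polyfunM; last by exists P.
apply: polyfunM; last first.
  apply: polyfun_prod => i _; apply: polyfunD; last exact: polyfunC.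
  by apply: polyfunM; [exact: polyfunC | exact: polyfunX].
apply: polyfunM; last by apply: polyfun_fact_scale; rewrite /K; lia.
apply: polyfun_prod_nat => i /andP[_ lt_in].
apply: polyfunM; first by apply: polyfunM; exact: polyfun_poch.
by apply: polyfun_fact_scale; rewrite /K; lia.
Qed.

(** * The formula for large [x] and its extension to all [x] *)

Lemma D_eq_rhs_large m n x : (m <= n)%N -> (0 < n)%N -> (n <= x)%N ->
  (D x%:Z (x + m)%N%:Z n)%:~R = rhs m n (P1 m n) x.
Proof.
move=> mn n0 nx; rewrite D_eq_g; [|lia|lia].
rewrite /rhs; set A := \prod_(1 <= i < n) _; rewrite -2!(mulrA A) P1E // [RHS]mulrA /A -big_split /=.
rewrite [LHS]mulrC; congr (_ * _); rewrite /dconst.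
(* The factor of index 0 cancels the inverse binomial in [dconst]. *)
rewrite -(prednK n0) big_ord_recl dfactor0 mulKf ?bin_neq0 // big_add1 big_mkord.
apply: eq_bigr => i _; rewrite /dfactor /= -[bump 0 i]/i.+1.
have -> : (x + (x + m) = 2 * x + m)%N by lia.
have -> : (2 * x + (x + m) = 3 * x + m)%N by lia.
have -> : (x + 2 * (x + m) = 3 * x + 2 * m)%N by lia.
ring.
Qed.

Theorem theorem2 (m n : nat) (hmn : (m <= n)%N) (hn : (1 <= n)%N) :
  exists P : {poly rat},
    (size P <= m./2 + 1)%N /\
    (forall x : nat,
       ((D x%:Z (x + m)%N%:Z n)%:~R : rat) =
       (\prod_(1 <= i < n)
          (((2 * x + m + i)`!)%:R * (poch (3 * x + m + 2 * i + 2) i)%:R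
             * (poch (3 * x + 2 * m + 2 * i + 2) i)%:R
           / (((x + 2 * i)`!)%:R * ((x + m + 2 * i)`!)%:R)))
       * (((2 * x + m)`!)%:R / (((x + m./2)`!)%:R * ((x + m)`!)%:R))
       * (\prod_(0 <= i < n./2) ((2 * x + 2 * uphalf m + 2 * i + 1)%N)%:R)
       * P.[x%:R]) /\
    (odd n && ~~ odd m -> (2%:R *: 'X + ((m + n)%N)%:R%:P) %| P).
Proof.
exists (P1 m n); split; first exact: size_P1.
split; last exact: dvdp_P1.
move=> x; rewrite -[RHS]/(rhs m n (P1 m n) x).
(* After multiplication by a nonzero scale both sides are polynomials in [x], and they agree for all
   x >= n. *)
apply: (mulIf (expf_neq0 n (dscale_neq0 (m + 2 * n) x))).
move: x; refine (polyfun_ext (polyfun_D_scale m n) (polyfun_rhs_scale m (P1 m n) hn) (x0 := n) _).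
by move=> y ny; rewrite D_eq_rhs_large.
Qed.
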